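(* Suppose that $(X,\tau)$ is a topological space with the Rothberger property and $\mathbb{P}$ is a forcing notion such that player TWO has a winning strategy in the game $\mathsf{CG}^{\omega}({<}\aleph_0)$ on $\mathbb{P}$. Then $$\Vdash_{\mathbb{P}}\text{``}(\check{X},\tau^{\mathbb{P}})\text{ has the Rothberger property''}.$$
   Context: A forcing notion is a poset; $q\le p$ means $q$ is stronger than $p$. $\Vdash_{\mathbb{P}}\varphi$ means every condition of $\mathbb{P}$ forces $\varphi$. For a space $(X,\tau)$ and a forcing notion $\mathbb{P}$, $\tau^{\mathbb{P}}$ denotes a $\mathbb{P}$-name for the topology on $X$ generated by $\tau$ (as a base) in a generic extension by $\mathbb{P}$. A space $(X,\tau)$ has the Rothberger property if for every sequence $\langle\mathcal{U}_n:n<\omega\rangle$ of open covers of $X$ there is an open cover $\{U_n:n<\omega\}$ of $X$ such that $U_n\in\mathcal{U}_n$ for all $n<\omega$. For an ordinal $\alpha$ and a cardinal $\kappa$, the cut-and-choose game $\mathsf{CG}^{<\alpha}({<}\kappa)$ on a poset $\mathbb{P}$ is played by ONE and TWO for $\alpha$ innings. In the beginning ONE chooses $p\in\mathbb{P}$. In each inning $\beta<\alpha$, ONE chooses a $\mathbb{P}$-name $\dot\eta_\beta$ for an ordinal, and then TWO chooses a set $C_\beta$ of ordinals with $|C_\beta|<\kappa$. TWO wins if for every $\gamma<\alpha$ there is $q_\gamma\in\mathbb{P}$ with $q_\gamma\le p$ and $q_\gamma\Vdash_{\mathbb{P}}$ ``$\forall\beta<\gamma\,(\dot\eta_\beta\in\check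 C_\beta)$''; otherwise ONE wins. $\mathsf{CG}^{\omega}({<}\kappa)$ denotes $\mathsf{CG}^{<\omega+1}({<}\kappa)$. *)

(* Defs.v *)
From mathcomp Require Import all_boot all_order.
From mathcomp Require Import boolp classical_sets cardinality wochoice.
From mathcomp Require Import topology.

Set Implicit Arguments.
Unset Strict Implicit.
Unset Printing Implicit Defensive.

Local Open Scope classical_set_scope.

(* Formulas of the language of set theory with parameters from [A], in
   higher-order abstract syntax.  Every concrete formula below is uniform in
   [A], so that the same formula can be evaluated in the ground model [V]
   ([sat]) and in the forcing language over [P] ([forces]). *)
Inductive fml (A : Type) : Type :=
| fMem of A & A
| fEq of A & A
| fNot of fml A
| fAnd of fml A & fml A
| fOr of fml A & fml A
| fImp of fml A & fml A
| fAll of (A -> fml A)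
| fEx of (A -> fml A).

Declare Scope fml_scope.
Delimit Scope fml_scope with fml.
Bind Scope fml_scope with fml.

Notation "x ∈ y" := (fMem x y) (at level 70, no associativity) : fml_scope.
Notation "x ≐ y" := (fEq x y) (at level 70, no associativity) : fml_scope.
Notation "f ⩑ g" := (fAnd f g) (at level 80, right associativity) : fml_scope.
Notation "f ⩒ g" := (fOr f g) (at level 85, right associativity) : fml_scope.
Notation "f ⇒ g" := (fImp f g) (at level 90, right associativity) : fml_scope.
Notation "f ⇔ g" := (fAnd (fImp f g) (fImp g f))
  (at level 95, no associativity) : fml_scope.
Notation "'ALL' x , f" := (fAll (fun x => f%fml))
  (at level 200, x name, right associativity) : fml_scope.
Notation "'EX' x , f" := (fEx (fun x => f%fml))
  (at level 200, x name, right associativity) : fml_scope.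
Notation "'ALLIN' x 'OF' a , f" := (fAll (fun x => fImp (fMem x a) f%fml))
  (at level 200, x name, right associativity) : fml_scope.
Notation "'EXIN' x 'OF' a , f" := (fEx (fun x => fAnd (fMem x a) f%fml))
  (at level 200, x name, right associativity) : fml_scope.

Section Formulas.
Variable A : Type.
Implicit Types a b f n s t u v w x y z B T X : A.
Local Open Scope fml_scope.

Definition is_subset a b : fml A := ALLIN x OF a, x ∈ b.

(* Von Neumann ordinals: transitive sets of transitive sets (with Foundation,
   exactly the transitive sets well-ordered by membership). *)
Definition is_transitive a : fml A := ALLIN x OF a, is_subset x a.
Definition is_ordinal a : fml A :=
  is_transitive a ⩑ (ALLIN x OF a, is_transitive x).

Definition is_empty a : fml A := ALL x, fNot (x ∈ a).
(* s = n ∪ {n} *)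
Definition is_succ s n : fml A := ALL x, x ∈ s ⇔ (x ∈ n ⩒ x ≐ n).
Definition is_inductive w : fml A :=
  (EXIN z OF w, is_empty z) ⩑
  (ALLIN n OF w, EXIN s OF w, is_succ s n).
Definition is_omega w : fml A :=
  is_inductive w ⩑ (ALL v, is_inductive v ⇒ is_subset w v).

(* u = {a, b} *)
Definition is_upair u a b : fml A := ALL x, x ∈ u ⇔ (x ≐ a ⩒ x ≐ b).
(* z = (a, b), the Kuratowski pair {{a}, {a, b}} *)
Definition is_opair z a b : fml A :=
  ALL u, u ∈ z ⇔ (is_upair u a a ⩒ is_upair u a b).
(* (a, b) ∈ f *)
Definition maps_to f a b : fml A := EXIN z OF f, is_opair z a b.
Definition is_function_on f w : fml A :=
  (ALLIN z OF f, EXIN a OF w, EX b, is_opair z a b) ⩑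
  (ALLIN a OF w, EX b,
     maps_to f a b ⩑ (ALL y, maps_to f a y ⇒ y ≐ b)).
Definition is_range r f : fml A := ALL y, y ∈ r ⇔ (EX a, maps_to f a y).

(* T is the topology on X having B as a base *)
Definition is_generated_topology X B T : fml A :=
  ALL u, u ∈ T ⇔
    (is_subset u X ⩑
     (ALLIN x OF u, EXIN b OF B, x ∈ b ⩑ is_subset b u)).

(* U is a cover of X by members of T *)
Definition is_open_cover X T U : fml A :=
  is_subset U T ⩑ (ALLIN x OF X, EXIN u OF U, x ∈ u).

Definition has_rothberger X T : fml A :=
  ALL w, is_omega w ⇒
  ALL F, (is_function_on F w ⩑
          (ALLIN n OF w, ALL U, maps_to F n U ⇒ is_open_cover X T U)) ⇒
  EX G, is_function_on G w ⩑
        (ALLIN n OF w, ALL u, ALL U,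
           maps_to G n u ⇒ maps_to F n U ⇒ u ∈ U) ⩑
        (EX R, is_range R G ⩑ is_open_cover X T R).

End Formulas.

(* The ground model: well-founded sets, given by small families of sets and
   compared with extensional equality. *)
Inductive V : Type := Sup (A : Type) of A -> V.

Fixpoint eqV (a b : V) : Prop :=
  let: Sup A f := a in let: Sup B g := b in
  (forall i : A, exists j : B, eqV (f i) (g j)) /\
  (forall j : B, exists i : A, eqV (f i) (g j)).

Definition memV (a b : V) : Prop :=
  let: Sup B g := b in exists j : B, eqV a (g j).

Lemma eqV_refl a : eqV a a.
Proof. by elim: a => A f IH /=; split=> i; exists i. Qed.

Lemma eqV_sym a b : eqV a b -> eqV b a.
Proof.
elim: a b => A f IH [B g] /= [ab ba]; split.
  by move=> j; have [i /IH] := ba j; exists i.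
by move=> i; have [j /IH] := ab i; exists j.
Qed.

Lemma eqV_trans a b c : eqV a b -> eqV b c -> eqV a c.
Proof.
elim: a b c => A f IH [B g] [C h] /= [ab ba] [bc cb]; split.
  move=> i; have [j e1] := ab i; have [k e2] := bc j.
  by exists k; apply: IH e1 e2.
move=> k; have [j e2] := cb k; have [i e1] := ba j.
by exists i; apply: IH e1 e2.
Qed.

Lemma memV_eq a b c : memV a b -> eqV b c -> memV a c.
Proof.
case: b c => B g [C h] [i ai] [/(_ i)[j ij] _]; exists j.
exact: eqV_trans ai ij.
Qed.

Lemma memV_irrefl a : ~ memV a a.
Proof.
elim: a => A f IH /= [j e]; apply: (IH j).
have sub v : eqV (Sup f) v -> memV (f j) v by case: v => B g /= [/(_ j)].
exact: sub e.
Qed.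

Fixpoint sat (phi : fml V) : Prop :=
  match phi with
  | fMem a b => memV a b
  | fEq a b => eqV a b
  | fNot f => ~ sat f
  | fAnd f g => sat f /\ sat g
  | fOr f g => sat f \/ sat g
  | fImp f g => sat f -> sat g
  | fAll f => forall a, sat (f a)
  | fEx f => exists a, sat (f a)
  end.

(* |c| < |K|: c is enumerated by a type into which K does not inject *)
Definition card_ltV (c : V) (K : Type) : Prop :=
  exists (A : Type) (f : A -> V),
    eqV c (Sup f) /\ ~ ([set: K] #<= [set: A])%card.

(* P-names: sets of pairs (name, condition), as small families. *)
Inductive name (P : Type) : Type :=
  Name (A : Type) of (A -> name P) & (A -> P).

Section Forcing.
Context {d : Order.disp_t} {P : porderType d}.
Implicit Types (p q r : P) (a b : name P).

(* The check name {(check y, p) | y in x, p in P}; no largest condition is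
   assumed. *)
Fixpoint check (x : V) : name P :=
  let: Sup A f := x in Name (fun ip : A * P => check (f ip.1)) snd.

Definition dense_below p (D : P -> Prop) : Prop :=
  forall r, (r <= p)%O -> exists2 q, (q <= r)%O & D q.

Fixpoint forces_eq a b (p : P) {struct a} : Prop :=
  let: Name A f s := a in let: Name B g t := b in
  (forall i : A, dense_below p (fun q => (q <= s i)%O ->
     exists j : B, (q <= t j)%O /\ forces_eq (f i) (g j) q)) /\
  (forall j : B, dense_below p (fun q => (q <= t j)%O ->
     exists i : A, (q <= s i)%O /\ forces_eq (f i) (g j) q)).

Definition forces_mem a b (p : P) : Prop :=
  let: Name B g t := b in
  dense_below p (fun q => exists j : B, (q <= t j)%O /\ forces_eq a (g j) q).

Fixpoint forces (p : P) (phi : fml (name P)) : Prop :=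
  match phi with
  | fMem a b => forces_mem a b p
  | fEq a b => forces_eq a b p
  | fNot f => forall q, (q <= p)%O -> ~ forces q f
  | fAnd f g => forces p f /\ forces p g
  | fOr f g => dense_below p (fun q => forces q f \/ forces q g)
  | fImp f g => forall q, (q <= p)%O -> forces q f -> forces q g
  | fAll f => forall a, forces p (f a)
  | fEx f => dense_below p (fun q => exists a, forces q (f a))
  end.

Definition forced (phi : fml (name P)) : Prop := forall p, forces p phi.

Definition ordinal_name a : Prop := forced (is_ordinal a).

(* The game CG^{<α}(<κ).  The ordinal α is given as a well-order (I, lt), so
   that both the innings and the bounds γ < α range over I, and κ as the
   cardinality of K.  A strategy of TWO sends ONE's initial condition p, ONE's
   moves eta and an inning i to TWO's answer; [non_anticipating] says that the
   answer depends only on the moves made up to inning i. *)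
Section CutAndChoose.
Context {I : Type} (lt : I -> I -> Prop) (K : Type).

Definition strategy : Type := P -> (I -> name P) -> I -> V.

Definition non_anticipating (S : strategy) : Prop :=
  forall p eta eta' i,
    (forall j, lt j i \/ j = i -> eta j = eta' j) -> S p eta i = S p eta' i.

Definition legal_answer (c : V) : Prop :=
  (forall x, memV x c -> sat (is_ordinal x)) /\ card_ltV c K.

Definition two_wins_play (p : P) (eta : I -> name P) (C : I -> V) : Prop :=
  forall gamma, exists2 q, (q <= p)%O &
    forall beta, lt beta gamma -> forces q (fMem (eta beta) (check (C beta))).

Definition winning (S : strategy) : Prop :=
  forall p eta, (forall i, ordinal_name (eta i)) ->
    (forall i, legal_answer (S p eta i)) /\ two_wins_play p eta (S p eta).

Definition TWO_has_winning_strategy : Prop :=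
  exists S : strategy, non_anticipating S /\ winning S.

End CutAndChoose.
End Forcing.

(* The well-order ω + 1 on option nat, with None on top *)
Definition lt_omega_plus_1 (i j : option nat) : Prop :=
  match i, j with
  | Some m, Some n => (m < n)%N
  | Some _, None => True
  | None, _ => False
  end.

(* CG^ω(<ℵ_0) = CG^{<ω+1}(<ℵ_0) *)
Definition TWO_wins_CG_omega_finite {d : Order.disp_t} (P : porderType d) :
    Prop :=
  @TWO_has_winning_strategy d P (option nat) lt_omega_plus_1 nat.

Definition open_cover (X : topologicalType) (U : set (set X)) : Prop :=
  U `<=` open /\ cover U id = [set: X].

Definition Rothberger (X : topologicalType) : Prop :=
  forall U : nat -> set (set X), (forall n, open_cover (U n)) ->
  exists u : nat -> set X, (forall n, U n (u n)) /\ open_cover (range u).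

(* In the ground model the points of X have to be sets: a coding [c] tells
   which set each point is.  By [point_coding_exists] every type of points has
   a coding. *)
Definition point_coding (X : Type) (c : X -> V) : Prop :=
  forall x y, eqV (c x) (c y) -> x = y.

Lemma point_coding_exists (X : topologicalType) :
  exists c : X -> V, point_coding c.
Proof.
have [R woR] := well_ordering_principle X.
have minR (A : pred X) x : A x -> exists2 z, A z & forall y, A y -> R z y.
  move=> Ax; have [|z [[Az lez] _]] := woR A; first by exists x.
  by exists z => // y; apply: lez.
pose lt x y := ~~ R y x.
have lt_wf : well_founded lt.
  move=> x; apply: contrapT => nx.
  have [|z /asboolP nz lez] := minR (fun z => `[< ~ Acc lt z >]) x.
    exact/asboolP.
  apply: nz; constructor => y; rewrite /lt => ltyz; apply: contrapT => ny.
  by move: ltyz; rewrite lez//; apply/asboolP.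
have lt_total x y : x <> y -> lt x y \/ lt y x.
  rewrite /lt => nxy; case: (boolP (R y x)) => [Ryx|]; last by left.
  right; apply/negP => Rxy; apply: nxy.
  have [|z [_ uniqz]] := woR (pred2 x y); first by exists x; rewrite inE eqxx.
  have R_refl u : R u u.
    by have [v /eqP -> le] := minR (pred1 u) u (eqxx u); apply: le; rewrite /= eqxx.
  rewrite -(uniqz x) ?(uniqz y)//; split=> [|u]; rewrite ?inE ?eqxx ?orbT//;
    by case/orP => /eqP ->.
pose step x (rec : forall y, lt y x -> V) : V :=
  Sup (fun y : {y | lt y x} => rec (sval y) (svalP y)).
pose c := Fix lt_wf (fun=> V) step.
have cE x : c x = Sup (fun y : {y | lt y x} => c (sval y)).
  rewrite /c Fix_eq// => {}x f g fg; rewrite /step; congr Sup.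
  by apply: funext => y; apply: fg.
have c_lt x y : lt x y -> ~ eqV (c x) (c y).
  move=> ltxy exy; apply: (@memV_irrefl (c x)).
  have : memV (c x) (c y) by rewrite (cE y); exists (exist _ x ltxy); apply: eqV_refl.
  by move=> /memV_eq; apply; apply: eqV_sym.
exists c => x y exy; apply: contrapT => /lt_total[] /c_lt; first by [].
by apply; apply: eqV_sym.
Qed.

Definition set_of_points (X : Type) (c : X -> V) (A : set X) : V :=
  Sup (fun x : {x | A x} => c (sval x)).

Definition set_of_opens (X : topologicalType) (c : X -> V) : V :=
  Sup (fun A : {A : set X | open A} => set_of_points c (sval A)).

(* Main.v *)
(** In the Rothberger game on X, let ONE simulate a run of the cut-and-choose
    game on P.  At inning n, for every point x there is a P-name for (the rank,
    in a well-order, of) the least ground-model open neighbourhood of x that is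
    contained in a member of the n-th cover of the extension.  TWO's winning
    strategy answers with a finite set of ranks, and the intersection W_x of the
    corresponding neighbourhoods of x is open in the ground model; ONE plays the
    cover {W_x : x in X}.  A choice of W_x in the Rothberger game determines the
    name that ONE plays in the cut-and-choose game.  By Pawlikowski's theorem
    this strategy of ONE is not winning, so in some run the chosen sets W_n
    cover X, and a condition q witnessing that TWO wins the cut-and-choose game
    forces each W_n to be contained in a member of the n-th cover. *)

Require Import Defs.
From mathcomp Require Import all_boot all_order.
From mathcomp Require Import boolp classical_sets cardinality.
From mathcomp Require Import wochoice topology.
From mathcomp Require Import zify.

Set Implicit Arguments.
Unset Strict Implicit.
Unset Printing Implicit Defensive.

Import Order.Theory.

Local Open Scope classical_set_scope.

(** * Pawlikowski's theorem *)

Lemma open_cst (X : topologicalType) (Q : Prop) : open [set _ : X | Q].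
Proof.
have [q|nq] := pselect Q.
  by rewrite (_ : mkset _ = setT); [exact: openT|apply/seteqP; split].
by rewrite (_ : mkset _ = set0); [exact: open0|apply/seteqP; split].
Qed.

Lemma open_forall_seq (X : topologicalType) (T : eqType) (s : seq T)
    (F : T -> set X) :
  (forall t, open (F t)) -> open [set x | forall t, t \in s -> F t x].
Proof.
move=> oF; elim: s => [|a s IH].
  rewrite (_ : mkset _ = [set _ | True]); first exact: open_cst.
  by apply/seteqP; split.
rewrite (_ : mkset _ = F a `&` [set x | forall t, t \in s -> F t x]).
  exact: openI.
apply/seteqP; split=> x /=.
  by move=> H; split=> [|t ts]; apply: H; rewrite inE ?eqxx ?ts ?orbT.
by move=> [Fa H] t; rewrite inE => /orP[/eqP->//|/H].
Qed.

(** One parameter bounds both the length and the entries, so each bound admits only finitely many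
    sequences. *)
Definition bounded_seq (a : nat) (s : seq nat) : bool :=
  (size s <= a) && all (fun i => i < a) s.

Lemma bounded_seq_finite a :
  exists l : seq (seq nat), forall s, bounded_seq a s -> s \in l.
Proof.
suff [l lP] : exists l : seq (seq nat),
    forall s, size s <= a -> all (fun i => i < a) s -> s \in l.
  by exists l => s /andP[]; apply: lP.
move: {1}a => n; elim: n => [|n [l IH]].
  by exists [:: [::]] => -[].
exists ([::] :: [seq i :: s | i <- iota 0 a, s <- l]) => -[|i s] //= ss /andP[ia sa].
rewrite inE; apply/orP; right; apply/allpairsP; exists (i, s); split=> //=.
  by rewrite mem_iota.
exact: IH.
Qed.

Lemma bounded_seqW a b s : a <= b -> bounded_seq a s -> bounded_seq b s.
Proof.
move=> ab /andP[sa /allP alls]; rewrite /bounded_seq (leq_trans sa ab) /=.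
by apply/allP => i /alls ia; apply: leq_trans ab.
Qed.

Lemma open_forall_bounded (X : topologicalType) a (F : seq nat -> set X) :
  (forall s, open (F s)) -> open [set x | forall s, bounded_seq a s -> F s x].
Proof.
move=> oF; have [l lP] := bounded_seq_finite a.
rewrite (_ : mkset _ =
  [set x | forall s, s \in l -> (bounded_seq a s -> F s x)]); last first.
  by apply/seteqP; split=> x /= H s; [move=> _|move=> sa]; apply: H => //; apply: lP.
apply: (@open_forall_seq _ _ _ (fun s => [set x | bounded_seq a s -> F s x])) => s.
case: (bounded_seq a s).
  rewrite (_ : mkset _ = F s)//; apply/seteqP; split=> x /=; first exact.
  by [].
rewrite (_ : mkset _ = [set _ | True]); first exact: open_cst.
by apply/seteqP; split.
Qed.

(** * Selections from the Rothberger property *)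

Section Rothberger.
Context (X : topologicalType) (roth : Rothberger X).

(** On an empty space the empty family is an open cover, and nothing can be selected from it. *)
Lemma Rothberger_point : exists x : X, True.
Proof.
apply: contrapT => noX.
have [|u [u0 _]] := roth (U := fun=> set0); last exact: u0 0.
by move=> n; split=> //; apply/seteqP; split=> // x; case: noX; exists x.
Qed.

Lemma Rothberger_choice (T : Type) (Q : nat -> T -> Prop)
    (W : nat -> T -> set X) :
  (forall n t, Q n t -> open (W n t)) ->
  (forall n x, exists2 t, Q n t & W n t x) ->
  exists f : nat -> T, (forall n, Q n (f n)) /\ forall x, exists n, W n (f n) x.
Proof.
move=> oW cW.
have [|u [uU [_ cu]]] := roth (U := fun n => W n @` Q n).
  move=> n; split=> [_ [t Qt <-]|]; first exact: oW Qt.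
  apply/seteqP; split=> // x _; have [t Qt Wt] := cW n x.
  by exists (W n t) => //; exists t.
have /choice[f fP] : forall n, exists t, Q n t /\ W n t = u n.
  by move=> n; have [t Qt e] := uU n; exists t.
exists f; split=> [n|x]; first by have [] := fP n.
have : cover (range u) id x by rewrite cu.
by move=> [_ [n _ <-] /= ux]; exists n; have [_ ->] := fP n.
Qed.

(** Applying the property to every tail of the sequence meets each point infinitely often; [m n]
    sums, hence bounds, the indices that the tails starting by [n] select at [n]. *)
Lemma Rothberger_often (A : nat -> nat -> set X) :
  (forall n k, open (A n k)) -> (forall n x, exists k, A n k x) ->
  exists m : nat -> nat, forall x N, exists n k, [/\ N <= n, k <= m n & A n k x].
Proof.
move=> oA cA.
have /choice[f fP] : forall N, exists f : nat -> nat,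
    forall x, exists n, A (N + n) (f n) x.
  move=> N; have [||f [_ fP]] := @Rothberger_choice nat (fun _ _ => True)
    (fun n k => A (N + n) k); first by move=> *; apply: oA.
    by move=> n x; have [k Ak] := cA (N + n) x; exists k.
  by exists f.
exists (fun n => \sum_(N < n.+1) f N (n - N)) => x N.
have [n An] := fP N x; exists (N + n), (f N n); split=> //; first exact: leq_addr.
have ltN : N < (N + n).+1 by rewrite ltnS leq_addr.
by rewrite (bigD1 (Ordinal ltN)) //= addKn; apply: leq_addr.
Qed.

(** * Strategies of ONE as trees of countable open covers *)

Section Tree.
(** [U s k] is the [k]-th set in the cover that ONE plays once TWO has chosen the indices [s]. *)
Context (U : seq nat -> nat -> set X).
Hypothesis oU : forall s k, open (U s k).
Hypothesis cU : forall s x, exists k, U s k x.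

Definition catches (a b : nat) : set X :=
  [set x | forall s, bounded_seq a s -> exists2 k, k < b & U s k x].

Lemma open_catches a b : open (catches a b).
Proof.
apply: (@open_forall_bounded _ a (fun s => [set x | exists2 k, k < b & U s k x])).
move=> s; rewrite (_ : mkset _ = \bigcup_(k in [set k | k < b]) U s k).
  exact: bigcup_open.
by apply/seteqP; split=> x /= [k]; exists k.
Qed.

Lemma catches_le a a' b b' :
  a' <= a -> b <= b' -> catches a b `<=` catches a' b'.
Proof.
move=> aa bb x H s /(bounded_seqW aa)/H[k kb Uk]; exists k => //.
exact: leq_trans bb.
Qed.

Lemma exists_catches a x : exists b, catches a b x.
Proof.
have [l lP] := bounded_seq_finite a.
have /choice[f fP] : forall s, exists k, U s k x by move=> s; apply: cU.
exists (\sum_(s <- l) (f s).+1) => s /lP sl; exists (f s) => //.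
by rewrite (big_rem s) //= leq_addr.
Qed.

(** A chain of [i] catching bounds starts at [a] and ends at or below [b]. *)
Fixpoint catches_iter (i a b : nat) : set X :=
  if i is i'.+1 then [set x | exists c, catches a c x /\ catches_iter i' c b x]
  else [set x | a <= b].

Lemma open_catches_iter i a b : open (catches_iter i a b).
Proof.
elim: i a => [|i IH] a /=.
  exact: open_cst.
rewrite (_ : mkset _ = \bigcup_c (catches a c `&` catches_iter i c b)).
  by apply: bigcup_open => c _; apply: openI; [apply: open_catches|].
by apply/seteqP; split=> x /=; [move=> [c]|move=> [c _]]; exists c.
Qed.

Lemma exists_catches_iter i a x : exists b, catches_iter i a b x.
Proof.
elim: i a => [|i IH] a; first by exists a => /=.
by have [c ac] := exists_catches a x; have [b cb] := IH c; exists b, c.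
Qed.

(** A sequence that outgrows the bounds [m n] on chains of [n] steps from [n] catches every point
    infinitely often, though it does not depend on the point. *)
Lemma exists_catching_sequence : exists M : nat -> nat,
  [/\ {homo M : i j / i < j}, (forall n, n < M n)
    & forall x N, exists2 n, N <= n & catches (M n) (M n.+1) x].
Proof.
have [||m mP] := @Rothberger_often (fun n k => catches_iter n n k).
- by move=> n k; apply: open_catches_iter.
- by move=> n x; apply: exists_catches_iter.
pose M n := \sum_(i < n.+1) (m i).+1.
have MS n : M n.+1 = M n + (m n.+1).+1 by rewrite /M big_ord_recr.
have Mlt : {homo M : i j / i < j}.
  by apply: homo_ltn ltn_trans _ => n; rewrite MS -addn1 leq_add2l.
have Mgt n : n < M n.
  by elim: n => [|n IH]; rewrite ?MS; [rewrite /M big_ord_recr big_ord0|lia].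
have mM n : m n < M n.
  by case: n => [|n]; rewrite ?MS /M ?big_ord_recr ?big_ord0 //=; lia.
have Mle i j : i <= j -> M i <= M j.
  by rewrite leq_eqVlt => /orP[/eqP->//|/Mlt/ltnW].
exists M; split=> // x N; apply: contrapT => noN.
(* Otherwise [M] grows more slowly than the iterates of the catching bound of
   [x], contrary to the choice of [m]. *)
have slow i n a b : N <= n -> M n <= a -> catches_iter i a b x -> M (n + i) <= b.
  elim: i n a => [|i IH] n a Nn Ma /=; first by rewrite addn0; apply: leq_trans.
  move=> [c [ac /IH cb]]; rewrite addnS -addSn; apply: cb; first exact: leqW.
  rewrite leqNgt; apply/negP => cM; apply: noN; exists n => //.
  by apply: catches_le ac => //; apply: ltnW.
(* Here [n] is at least [M N], so a chain of [n] steps from [n] gives [M (N + n) <= k], whereas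
   [k <= m n < M n]. *)
have [n [k [Nn km nk]]] := mP x (N + M N).
have := slow n N n k (leqnn _) _ nk.
have := Mle n (N + n) (leq_addl _ _); have := mM n; lia.
Qed.

(* Pawlikowski's theorem: in the Rothberger game, a strategy of ONE, presented
   as a tree of countable open covers, is beaten along some branch. *)
Lemma Rothberger_branch :
  exists f : nat -> nat, forall x, exists n, U (mkseq f n) (f n) x.
Proof.
have [M [Mlt Mgt MP]] := exists_catching_sequence.
have Mle i j : i <= j -> M i <= M j.
  by rewrite leq_eqVlt => /orP[/eqP->//|/Mlt/ltnW].
(* A reply [phi] prescribes an index at every position. [E n phi] collects the points it covers at
   all positions bounded by [M n], so it is fixed before the branch is known. *)
pose bound n (phi : seq nat -> nat) := forall s, phi s < M n.+1.
pose E n phi := [set x | forall s, bounded_seq (M n) s -> U s (phi s) x].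
have oE n phi : open (E n phi) by apply: open_forall_bounded.
have EP x N : exists n phi, [/\ N <= n, bound n phi & E n phi x].
  have [n Nn xn] := MP x N; exists n.
  have /choice[phi phiP] : forall s, exists k,
      k < M n.+1 /\ (bounded_seq (M n) s -> U s k x).
    move=> s; case: (boolP (bounded_seq (M n) s)) => [/xn[k kM Uk]|_].
      by exists k.
    by exists 0; split=> //; apply: leq_ltn_trans (Mgt _).
  by exists phi; split=> // s; have [] := phiP s.
(* Finite intersections of more and more distinct indices, so that every
   selected set can be charged to an index of its own. *)
pose good j (l : seq (nat * (seq nat -> nat))) :=
  [/\ size l = j.+1, uniq (map fst l) & forall e, e \in l -> bound e.1 e.2].
have [||g [gQ gP]] := @Rothberger_choice _ good
    (fun j l => [set x | forall e, e \in l -> E e.1 e.2 x]).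
- move=> j l _; apply: (@open_forall_seq _ _ _ (fun e => E e.1 e.2)) => e.
  exact: oE.
- move=> j x.
  elim: j => [|j [l [sl ul bl] El]].
    have [n [phi [_ bphi Ephi]]] := EP x 0.
    by exists [:: (n, phi)]; first split=> //; move=> e; rewrite inE => /eqP->.
  (* This threshold exceeds every index in [l], so [n] is new. *)
  have [n [phi [ln bphi Ephi]]] := EP x (\sum_(e <- l) e.1.+1).
  exists ((n, phi) :: l); first split=> /=; rewrite ?sl ?ul ?andbT//.
  + apply/mapP => -[e el /= ne]; move: ln; rewrite (big_rem e) //= -ne; lia.
  + by move=> e; rewrite inE => /orP[/eqP->|/bl].
  + by move=> e; rewrite inE => /orP[/eqP->|/El].
pose pick j (ns : seq nat) := head 0 [seq n <- map fst (g j) | n \notin ns].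
pose ns := fix ns (j : nat) : seq nat :=
  if j is i.+1 then rcons (ns i) (pick i (ns i)) else [::].
have size_ns j : size (ns j) = j by elim: j => //= j IH; rewrite size_rcons IH.
have ns_sub i j : i < j -> pick i (ns i) \in ns j.
  elim: j => // j IH; rewrite ltnS leq_eqVlt /= mem_rcons inE.
  by case/orP => [/eqP->|/IH->]; rewrite ?eqxx ?orbT.
have pickP j : pick j (ns j) \in map fst (g j) /\ pick j (ns j) \notin ns j.
  have [sg ug _] := gQ j.
  have : has (fun n => n \notin ns j) (map fst (g j)).
    apply/negPn/negP; rewrite -all_predC => /allP/= H.
    have := @uniq_leq_size _ _ (ns j) ug (fun n ng => negbNE (H n ng)).
    by rewrite size_map sg size_ns ltnn.
  rewrite has_filter /pick.
  case e : [seq n <- map fst (g j) | n \notin ns j] => [|n s] //= _.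
  have : n \in [seq n <- map fst (g j) | n \notin ns j] by rewrite e mem_head.
  by rewrite mem_filter => /andP[].
have pick_inj i j : pick i (ns i) = pick j (ns j) -> i = j.
  move=> e; case: (ltngtP i j) => // /ns_sub; [rewrite e|rewrite -e];
    by rewrite (negbTE (pickP _).2).
(* Distinct [j] charge distinct [n], so one reply per inning serves them all; innings that are not
   charged reply 0. *)
have /choice[phi phiP] : forall n, exists phi, bound n phi /\
    forall j, pick j (ns j) = n -> (n, phi) \in g j.
  move=> n; have [[j jn]|noj] := pselect (exists j, pick j (ns j) = n).
    have /mapP[[n' phi] eg /= en] := (pickP j).1.
    rewrite -en jn in eg; exists phi; split; first by have [_ _ /(_ _ eg)] := gQ j.
    by move=> i; rewrite -jn => /pick_inj->; rewrite jn.
  exists (fun=> 0); split=> [s|j jn]; first exact: leq_ltn_trans (Mgt _).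
  by case: noj; exists j.
(* Following these replies gives the branch; their bounds keep its initial segment of length [n]
   bounded by [M n], where [E n (phi n)] applies. *)
pose fs := fix fs (n : nat) : seq nat :=
  if n is i.+1 then rcons (fs i) (phi i (fs i)) else [::].
pose f n := phi n (fs n).
have fsE n : mkseq f n = fs n.
  elim: n => //= n IH; rewrite -IH -[in RHS]/(f n) /mkseq -cats1.
  by rewrite -[n.+1]addn1 iotaD map_cat /=  /f -IH.
have bounded_fs n : bounded_seq (M n) (mkseq f n).
  rewrite /bounded_seq size_mkseq ltnW //=; apply/allP => k /mapP[i].
  rewrite mem_iota add0n /= => iltn ->.
  by apply: leq_trans (Mle _ _ iltn); have [/(_ (fs i))] := phiP i.
exists f => x; have [j xj] := gP x.
set n := pick j (ns j).
have [_ /(_ j erefl) /xj/(_ _ (bounded_fs n))] := phiP n.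
by exists n; rewrite /f -fsE.
Qed.

End Tree.
End Rothberger.

(** * The forcing relation *)

Definition idx {P} (a : name P) : Type := let: Name A _ _ := a in A.
Definition elt {P} (a : name P) : idx a -> name P := let: Name _ f _ := a in f.
Definition cond {P} (a : name P) : idx a -> P := let: Name _ _ s := a in s.
Arguments elt {P} a i.
Arguments cond {P} a i.

Section ForcingCalculus.
Context {d : Order.disp_t} {P : porderType d}.
Implicit Types (p q r : P) (a b x y z u : name P) (phi psi : fml (name P)).

Lemma dense_below_le p q D : (q <= p)%O -> dense_below p D -> dense_below q D.
Proof. by move=> qp Dp r rq; apply: Dp; apply: le_trans qp. Qed.

Lemma dense_below_self p (D : P -> Prop) :
  (forall q, (q <= p)%O -> D q) -> dense_below p D.
Proof. by move=> Dp r rp; exists r => //; apply: Dp. Qed.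

Lemma dense_below_bind p (D E : P -> Prop) :
  dense_below p D -> (forall q, (q <= p)%O -> D q -> dense_below q E) ->
  dense_below p E.
Proof.
move=> Dp DE r rp; have [q qr Dq] := Dp r rp.
have [s sq Es] := DE q (le_trans qr rp) Dq q (lexx q).
by exists s => //; apply: le_trans qr.
Qed.

Lemma forces_eqE a b p : forces_eq a b p <->
  (forall i, dense_below p (fun q => (q <= cond a i)%O ->
     exists j, (q <= cond b j)%O /\ forces_eq (elt a i) (elt b j) q)) /\
  (forall j, dense_below p (fun q => (q <= cond b j)%O ->
     exists i, (q <= cond a i)%O /\ forces_eq (elt a i) (elt b j) q)).
Proof. by case: a b => A f s [B g t]. Qed.

Lemma forces_memE a b p : forces_mem a b p <->
  dense_below p (fun q => exists j, (q <= cond b j)%O /\ forces_eq a (elt b j) q).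
Proof. by case: b => B g t. Qed.

Lemma name_elt_ind (Q : name P -> Prop) :
  (forall a, (forall i, Q (elt a i)) -> Q a) -> forall a, Q a.
Proof. by move=> H; elim=> A f IH s; apply: H. Qed.

Lemma forces_eq_le a b p q : (q <= p)%O -> forces_eq a b p -> forces_eq a b q.
Proof.
by move=> qp /forces_eqE[h1 h2]; apply/forces_eqE; split=> i;
  apply: dense_below_le qp _.
Qed.

Lemma forces_eq_local a b p : dense_below p (forces_eq a b) -> forces_eq a b p.
Proof.
move=> D; apply/forces_eqE; split=> i; apply: dense_below_bind D _ => q _;
  by move=> /forces_eqE[].
Qed.

Lemma forces_le phi p q : (q <= p)%O -> forces p phi -> forces q phi.
Proof.
elim: phi p q => /=.
- move=> a b p q qp /forces_memE D; apply/forces_memE; exact: dense_below_le qp D.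
- by move=> a b p q; apply: forces_eq_le.
- by move=> f IH p q qp nf r rq; apply: nf; apply: le_trans qp.
- by move=> f IHf g IHg p q qp [hf hg]; split; [apply: IHf hf|apply: IHg hg].
- by move=> f _ g _ p q; apply: dense_below_le.
- by move=> f _ g _ p q qp fg r rq; apply: fg; apply: le_trans qp.
- by move=> f IH p q qp hf a; apply: IH (hf a).
- by move=> f _ p q; apply: dense_below_le.
Qed.

(** Existential clauses are density statements and absorb a further density; negation and
    implication also use persistence. Goals can thus be proved on a dense set of stronger
    conditions. *)
Lemma forces_local phi p : dense_below p (forces^~ phi) -> forces p phi.
Proof.
elim: phi p => /=.
- move=> a b p D; apply/forces_memE; apply: dense_below_bind D _ => q _.
  by move=> /forces_memE.
- by move=> a b p; apply: forces_eq_local.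
- move=> f _ p D q qp fq; have [r rq /(_ r (lexx r))] := D q qp; apply.
  exact: forces_le fq.
- move=> f IHf g IHg p D; split; [apply: IHf|apply: IHg];
    by apply: dense_below_bind D _ => q _ [hf hg]; apply: dense_below_self => r rq;
    apply: forces_le rq _.
- by move=> f _ g _ p D; apply: dense_below_bind D _.
- move=> f _ g IHg p D q qp fq; apply: IHg.
  apply: dense_below_bind (dense_below_le qp D) _ => r rq fg.
  apply: dense_below_self => s sr; apply: fg => //.
  by apply: forces_le fq; apply: le_trans rq.
- move=> f IH p D a; apply: IH; apply: dense_below_bind D _ => q _ hf.
  by apply: dense_below_self => r rq; apply: forces_le rq _.
- by move=> f _ p D; apply: dense_below_bind D _.
Qed.

Lemma forces_eq_refl a p : forces_eq a a p.
Proof.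
elim/name_elt_ind: a p => a IH p; apply/forces_eqE.
by split=> i; apply: dense_below_self => q qp qa; exists i.
Qed.

Lemma forces_eq_elt a b p i q : forces_eq a b p -> (q <= p)%O ->
  (q <= cond a i)%O -> forces_mem (elt a i) b q.
Proof.
move=> /forces_eqE[ab _] qp qi; apply/forces_memE.
move=> r rq; have [s sr H] := ab i r (le_trans rq qp).
by exists s => //; apply: H; apply: le_trans (le_trans rq qi).
Qed.

Lemma forces_eq_sym a b p : forces_eq a b p -> forces_eq b a p.
Proof.
elim/name_elt_ind: a b p => a IH b p /forces_eqE[ab ba]; apply/forces_eqE.
split=> i r rp; [have [q qr H] := ba i r rp|have [q qr H] := ab i r rp];
  by exists q => // /H[j [qj e]]; exists j; split=> //; apply: IH.
Qed.

Lemma forces_eq_trans b a c p :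
  forces_eq a b p -> forces_eq b c p -> forces_eq a c p.
Proof.
elim/name_elt_ind: a b c p => a IH b c p /forces_eqE[ab ba] /forces_eqE[bc cb].
apply/forces_eqE; split=> i r rp.
  (* Either some [s] below [r] lies under [cond a i] and the two witnesses chain below it, or none
     does and [r] meets the clause vacuously. *)
  case: (pselect (exists2 s, s <= r & s <= cond a i)%O) => [[s sr si]|no].
    have [q qs] := ab i s (le_trans sr rp).
    case=> [|j [qj e]]; first exact: le_trans si.
    have [t tq] := bc j q (le_trans qs (le_trans sr rp)).
    case=> [|k [tk e']]; first exact: le_trans qj.
    exists t; first by apply: le_trans sr; apply: le_trans qs.
    by move=> _; exists k; split=> //; apply: IH e'; apply: forces_eq_le e.
  by exists r => // ri; case: no; exists r.
case: (pselect (exists2 s, s <= r & s <= cond c i)%O) => [[s sr si]|no].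
  have [q qs] := cb i s (le_trans sr rp).
  case=> [|j [qj e]]; first exact: le_trans si.
  have [t tq] := ba j q (le_trans qs (le_trans sr rp)).
  case=> [|k [tk e']]; first exact: le_trans qj.
  exists t; first by apply: le_trans sr; apply: le_trans qs.
  by move=> _; exists k; split=> //; apply: IH e' _; apply: forces_eq_le e.
by exists r => // ri; case: no; exists r.
Qed.

Lemma forces_mem_eq a a' b b' p : forces_eq a a' p -> forces_eq b b' p ->
  forces_mem a b p -> forces_mem a' b' p.
Proof.
move=> ea eb /forces_memE D; apply/forces_memE; apply: dense_below_bind D _.
move=> q qp [j [qj e]]; have /forces_memE := forces_eq_elt eb qp qj.
move/dense_below_bind; apply=> r rq [k [rk e']]; apply: dense_below_self => s sr.
exists k; split; first exact: le_trans rk.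
apply: forces_eq_trans (forces_eq_le sr e').
apply: forces_eq_trans (forces_eq_le (le_trans sr rq) e).
apply: forces_eq_sym; apply: forces_eq_le ea.
by apply: le_trans sr _; apply: le_trans rq _.
Qed.

(* Formulas that differ by replacing parameters along [E].  For
   [E := fun a b => forces_eq a b p] such formulas are equivalent below [p]. *)
Inductive fcong (E : name P -> name P -> Prop) :
    fml (name P) -> fml (name P) -> Prop :=
| cMem a a' b b' : E a a' -> E b b' -> fcong E (fMem a b) (fMem a' b')
| cEq a a' b b' : E a a' -> E b b' -> fcong E (fEq a b) (fEq a' b')
| cNot f f' : fcong E f f' -> fcong E (fNot f) (fNot f')
| cAnd f f' g g' : fcong E f f' -> fcong E g g' -> fcong E (fAnd f g) (fAnd f' g')
| cOr f f' g g' : fcong E f f' -> fcong E g g' -> fcong E (fOr f g) (fOr f' g')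
| cImp f f' g g' : fcong E f f' -> fcong E g g' -> fcong E (fImp f g) (fImp f' g')
| cAll f f' : (forall x, fcong E (f x) (f' x)) -> fcong E (fAll f) (fAll f')
| cEx f f' : (forall x, fcong E (f x) (f' x)) -> fcong E (fEx f) (fEx f').

Lemma forces_fcong p phi psi : fcong (fun a b => forces_eq a b p) phi psi ->
  forall q, (q <= p)%O -> forces q phi <-> forces q psi.
Proof.
elim=> [a a' b b' ea eb|a a' b b' ea eb|f f' _ IH|f f' g g' _ IHf _ IHg
  |f f' g g' _ IHf _ IHg|f f' g g' _ IHf _ IHg|f f' _ IH|f f' _ IH] q qp /=.
- have {}ea := forces_eq_le qp ea; have {}eb := forces_eq_le qp eb.
  split; first exact: forces_mem_eq.
  by apply: forces_mem_eq; apply: forces_eq_sym.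
- have {}ea := forces_eq_le qp ea; have {}eb := forces_eq_le qp eb.
  split=> e.
    by apply: forces_eq_trans eb; apply: forces_eq_trans e; apply: forces_eq_sym.
  by apply: forces_eq_trans (forces_eq_sym eb); apply: forces_eq_trans e.
- by split=> H r rq fr; apply: (H r rq); apply/IH => //; apply: le_trans qp.
- by rewrite IHf// IHg.
- split=> D; apply: dense_below_bind D _ => r rq H; have rp := le_trans rq qp;
    apply: dense_below_self => s sr; have sp := le_trans sr rp;
    by case: H => H; [left; apply/(IHf s sp)|right; apply/(IHg s sp)];
    apply: forces_le H.
- split=> H r rq; have rp := le_trans rq qp.
    by rewrite -IHf// -IHg//; apply: H.
  by rewrite IHf// IHg//; apply: H.
- by split=> H a; apply/(IH a q qp).
- by split=> D; apply: dense_below_bind D _ => r rq [a /(IH _ _ (le_trans rq qp)) H];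
   apply: dense_below_self => s sr; exists a; apply: forces_le H.
Qed.

End ForcingCalculus.

Ltac fcongruence := repeat match goal with
  | |- fcong _ _ _ => constructor
  | |- forall _, _ => intro
  end; try assumption; try apply: forces_eq_refl.

(** * Natural deduction for forced formulas *)

Section Deduction.
Context {d : Order.disp_t} {P : porderType d}.
Implicit Types (p q r : P) (a b x y z u : name P) (phi psi : fml (name P)).

Lemma forces_subst phi psi p :
  fcong (fun a b => forces_eq a b p) phi psi -> forces p phi -> forces p psi.
Proof. by move=> /forces_fcong E /E; apply. Qed.

(* Introducing with these keeps the goal in the form [forces _ _], on which the
   elimination lemmas below act. *)
Lemma forces_impI p f g :
  (forall q, (q <= p)%O -> forces q f -> forces q g) -> forces p (fImp f g).
Proof. by []. Qed.

Lemma forces_allI p (f : name P -> fml (name P)) :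
  (forall x, forces p (f x)) -> forces p (fAll f).
Proof. by []. Qed.

Lemma forces_allinI p a (f : name P -> fml (name P)) :
  (forall x q, (q <= p)%O -> forces q (fMem x a) -> forces q (f x)) ->
  forces p (fAll (fun x => fImp (fMem x a) (f x))).
Proof. by move=> H x q; apply: H. Qed.

Lemma forces_iffI p f g :
  (forall q, (q <= p)%O -> forces q f -> forces q g) ->
  (forall q, (q <= p)%O -> forces q g -> forces q f) ->
  forces p (fAnd (fImp f g) (fImp g f)).
Proof. by []. Qed.

Lemma upair_iff u a b x p : forces p (is_upair u a b) ->
  forces p (fMem x u) <-> forces p (fOr (fEq x a) (fEq x b)).
Proof. by move=> H; have [h1 h2] := H x; split; [apply: h1|apply: h2]. Qed.

Lemma opair_iff z a b u p : forces p (is_opair z a b) ->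
  forces p (fMem u z) <-> forces p (fOr (is_upair u a a) (is_upair u a b)).
Proof. by move=> H; have [h1 h2] := H u; split; [apply: h1|apply: h2]. Qed.

Lemma forces_exE p (f : name P -> fml (name P)) phi : forces p (fEx f) ->
  (forall q x, (q <= p)%O -> forces q (f x) -> forces q phi) -> forces p phi.
Proof.
move=> D H; apply: forces_local; apply: dense_below_bind D _ => q qp [x fx].
by apply: dense_below_self => r rq; apply: forces_le rq _; apply: H fx.
Qed.

Lemma forces_exI x p (f : name P -> fml (name P)) :
  forces p (f x) -> forces p (fEx f).
Proof.
by move=> fx; apply: dense_below_self => q qp; exists x; apply: forces_le fx.
Qed.

Lemma forces_orE p f g phi : forces p (fOr f g) ->
  (forall q, (q <= p)%O -> forces q f -> forces q phi) ->
  (forall q, (q <= p)%O -> forces q g -> forces q phi) -> forces p phi.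
Proof.
move=> D Hf Hg; apply: forces_local; apply: dense_below_bind D _ => q qp H.
apply: dense_below_self => r rq; apply: forces_le rq _.
by case: H; [apply: Hf|apply: Hg].
Qed.

Lemma forces_orIl p f g : forces p f -> forces p (fOr f g).
Proof. by move=> pf; apply: dense_below_self => q qp; left; apply: forces_le pf. Qed.

Lemma forces_orIr p f g : forces p g -> forces p (fOr f g).
Proof.
by move=> pf; apply: dense_below_self => q qp; right; apply: forces_le pf.
Qed.

Lemma forces_in p a b phi : forces p (fMem a b) ->
  (forall q i, (q <= p)%O -> (q <= cond b i)%O ->
     forces_eq a (elt b i) q -> forces q phi) -> forces p phi.
Proof.
move=> /forces_memE D H; apply: forces_local; apply: dense_below_bind D _.
move=> q qp [i [qi e]]; apply: dense_below_self => r rq; apply: forces_le rq _.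
exact: H e.
Qed.

Lemma forces_memI a b i p :
  (p <= cond b i)%O -> forces_eq a (elt b i) p -> forces p (fMem a b).
Proof.
move=> pi e; apply/forces_memE; apply: dense_below_self => q qp; exists i.
by split; [apply: le_trans pi|apply: forces_eq_le e].
Qed.

Lemma forces_eqI a b p :
  (forall i q, (q <= p)%O -> (q <= cond a i)%O -> forces_mem (elt a i) b q) ->
  (forall i q, (q <= p)%O -> (q <= cond b i)%O -> forces_mem (elt b i) a q) ->
  forces_eq a b p.
Proof.
move=> ab ba; apply/forces_eqE; split=> i r rp.
  case: (pselect (exists2 s, s <= r & s <= cond a i)%O) => [[s sr si]|no].
    have /forces_memE := ab i s (le_trans sr rp) si.
    by move=> /(_ s (lexx s))[q qs [j H]]; exists q;
      [apply: le_trans sr|exists j].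
  by exists r => // ri; case: no; exists r.
case: (pselect (exists2 s, s <= r & s <= cond b i)%O) => [[s sr si]|no].
  have /forces_memE := ba i s (le_trans sr rp) si.
  move=> /(_ s (lexx s))[q qs [j [qj e]]]; exists q; first exact: le_trans sr.
  by exists j; split=> //; apply: forces_eq_sym.
by exists r => // ri; case: no; exists r.
Qed.

Lemma forces_ext a b p : (forall x q, (q <= p)%O ->
  forces q (fMem x a) <-> forces q (fMem x b)) -> forces_eq a b p.
Proof.
move=> H; apply: forces_eqI => i q qp qi; apply/(H _ _ qp);
  exact: forces_memI qi (forces_eq_refl _ _).
Qed.

Lemma forces_in_check a w p phi : forces p (fMem a (check w)) ->
  (forall q v, (q <= p)%O -> memV v w -> forces_eq a (check v) q ->
     forces q phi) -> forces p phi.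
Proof.
move=> aw H; apply: forces_in aw _; case: w H => A f H q /= i qp _; apply: H => //.
by exists i.1; apply: eqV_refl.
Qed.

(** * Absoluteness of check names *)

Lemma check_eq v w p : eqV v w -> forces_eq (check v) (check w) p.
Proof.
elim: v w p => A f IH [B g] p /= [fg gf].
split=> i q qp; exists q => // qi.
  by have [j e] := fg i.1; exists (j, q); split=> //; apply: IH.
by have [j e] := gf i.1; exists (j, q); split=> //; apply: IH.
Qed.

Lemma check_eqE v w p : forces_eq (check v) (check w) p -> eqV v w.
Proof.
elim: v w p => A f IH [B g] p /= [fg gf]; split=> i.
  (* The index [(i, p)] carries the condition [p], so every [q] below [p] satisfies the
     antecedent. *)
  have [q qp /(_ qp)[j [_ e]]] := fg (i, p) p (lexx p).
  by exists j.1; apply: IH e.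
have [q qp /(_ qp)[j [_ e]]] := gf (i, p) p (lexx p).
by exists j.1; apply: IH e.
Qed.

Lemma check_mem v w p : memV v w -> forces p (fMem (check v) (check w)).
Proof.
case: w => B g [j e]; apply: (@forces_memI _ (check (Sup g)) (j, p)) => //=.
exact: check_eq.
Qed.

Lemma check_memE v w p : forces p (fMem (check v) (check w)) -> memV v w.
Proof.
case: w => B g /(_ p (lexx p))[q _ [j [_ e]]]; exists j.1.
exact: check_eqE e.
Qed.

Lemma forces_is_subset v w p : (forall t, memV t v -> memV t w) ->
  forces p (is_subset (check v) (check w)).
Proof.
move=> vw; apply: forces_allinI => x q qp xv.
apply: forces_in_check xv _ => r y rq /vw yw e.
apply: forces_subst (check_mem _ yw); fcongruence; exact: forces_eq_sym.
Qed.

(** * Kuratowski pairs in the extension *)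

Definition upair_name a b : name P :=
  Name (fun i : bool * P => if i.1 then a else b) snd.

Lemma upair_nameP a b p : forces p (is_upair (upair_name a b) a b).
Proof.
move=> x; apply: forces_iffI => q qp H.
  apply: forces_in H _ => r [[] s] rq _ e; first exact: forces_orIl.
  exact: forces_orIr.
apply: forces_orE H _ _ => r rq e.
  exact: (@forces_memI _ (upair_name a b) (true, r)).
exact: (@forces_memI _ (upair_name a b) (false, r)).
Qed.

Lemma upair_uniq u v a b p : forces p (is_upair u a b) ->
  forces p (is_upair v a b) -> forces_eq u v p.
Proof.
move=> ua va; apply: forces_ext => x q qp; have [h1 h2] := ua x.
by have [h3 h4] := va x; split=> [/(h1 _ qp)|/(h3 _ qp)]; [apply: h4|apply: h2].
Qed.

Lemma upair_memE u a b x p phi : forces p (is_upair u a b) ->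
  forces p (fMem x u) ->
  (forall q, (q <= p)%O -> forces_eq x a q -> forces q phi) ->
  (forall q, (q <= p)%O -> forces_eq x b q -> forces q phi) -> forces p phi.
Proof. by move=> /upair_iff-/(_ x) H /H; apply: forces_orE. Qed.

Lemma upair_memL u a b p : forces p (is_upair u a b) -> forces p (fMem a u).
Proof.
by move=> H; apply/(upair_iff _ H); apply: forces_orIl; apply: forces_eq_refl.
Qed.

Lemma upair_memR u a b p : forces p (is_upair u a b) -> forces p (fMem b u).
Proof.
by move=> H; apply/(upair_iff _ H); apply: forces_orIr; apply: forces_eq_refl.
Qed.

Definition opair_name a b := upair_name (upair_name a a) (upair_name a b).

Lemma opair_nameP a b p : forces p (is_opair (opair_name a b) a b).
Proof.
have up a' b' u q :
    forces_eq u (upair_name a' b') q <-> forces q (is_upair u a' b').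
  split=> [e|H]; last exact: upair_uniq H (upair_nameP _ _ _).
  apply: forces_subst (upair_nameP a' b' q); rewrite /is_upair;
    fcongruence; exact: forces_eq_sym.
move=> u; have H0 q := upair_iff u (upair_nameP (upair_name a a) (upair_name a b) q).
apply: forces_iffI => q qp H.
  apply: forces_orE ((H0 q).1 H) _ _ => r rq /up; first exact: forces_orIl.
  exact: forces_orIr.
apply/H0; apply: forces_orE H _ _ => r rq /up e; first exact: forces_orIl.
exact: forces_orIr.
Qed.

(** The singleton of [a] lies in [z], so [a'] belongs to it. The pair of [a] and [b] lies in [z], so
    [b] equals [a'] or [b']; in the first case the symmetric alternative for [b'] closes the
    circle. *)
Lemma opair_inj z a b a' b' p : forces p (is_opair z a b) ->
  forces p (is_opair z a' b') -> forces_eq a a' p /\ forces_eq b b' p.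
Proof.
have fst_eq c e c' e' q : forces q (is_opair z c e) ->
    forces q (is_opair z c' e') -> forces q (fEq c c').
  move=> h h'; have H : forces q (fMem (upair_name c c) z).
    apply/(opair_iff _ h).
    by apply: forces_orIl; apply: upair_nameP.
  move/(opair_iff _ h') in H.
  have mem r : (r <= q)%O -> forces r (fMem c' (upair_name c c)) ->
      forces r (fEq c c').
    move=> rq /(upair_memE (upair_nameP c c r)); apply=> s sr;
      exact: forces_eq_sym.
  by apply: forces_orE H _ _ => r rq /upair_memL; apply: mem.
have snd_eq c e c' e' q : forces q (is_opair z c e) ->
    forces q (is_opair z c' e') -> forces q (fOr (fEq e c') (fEq e e')).
  move=> h h'; have H : forces q (fMem (upair_name c e) z).
    apply/(opair_iff _ h).
    by apply: forces_orIr; apply: upair_nameP.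
  move/(opair_iff _ h') in H.
  apply: forces_orE H _ _ => r rq up; have em := upair_memR (upair_nameP c e r).
    by apply: (upair_memE up em) => s sr es; apply: forces_orIl.
  apply: (upair_memE up em) => s sr es; first exact: forces_orIl.
  exact: forces_orIr.
move=> h h'; have aa' : forces p (fEq a a') by apply: fst_eq h h'.
split=> //; rewrite -/(forces p (fEq b b')).
apply: forces_orE (snd_eq _ _ _ _ _ h h') _ _ => // q qp ba'.
apply: forces_orE (forces_le qp (snd_eq _ _ _ _ _ h' h)) _ _ => r rq b'x;
  last exact: forces_eq_sym.
apply: forces_eq_trans (forces_eq_sym b'x).
apply: forces_eq_trans (forces_eq_le rq ba') _; apply: forces_eq_sym.
by apply: forces_eq_le aa'; apply: le_trans qp.
Qed.

Lemma maps_to_eq F a b F' a' b' p : forces_eq F F' p -> forces_eq a a' p ->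
  forces_eq b b' p -> forces p (maps_to F a b) -> forces p (maps_to F' a' b').
Proof.
move=> eF ea eb; apply: forces_subst.
by rewrite /maps_to /is_opair /is_upair; fcongruence.
Qed.

Lemma function_onE F w a p : forces p (is_function_on F w) ->
  forces p (fMem a w) ->
  forces p (EX b, maps_to F a b ⩑ (ALL y, maps_to F a y ⇒ y ≐ b))%fml.
Proof. by move=> [_ H] aw; apply: H aw. Qed.

Lemma maps_to_fun F w a b b' p : forces p (is_function_on F w) ->
  forces p (fMem a w) -> forces p (maps_to F a b) -> forces p (maps_to F a b') ->
  forces_eq b b' p.
Proof.
move=> Fw aw ab ab'; rewrite -/(forces p (fEq b b')).
apply: forces_exE (function_onE Fw aw) _ => q y qp [_ uniq].
apply: forces_eq_trans (uniq b q (lexx q) (forces_le qp ab)) _.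
exact: forces_eq_sym (uniq b' q (lexx q) (forces_le qp ab')).
Qed.

End Deduction.

(** * Names for least witnesses *)

Record strict_well_order (T : Type) (lt : T -> T -> Prop) : Prop := {
  swo_wf : well_founded lt;
  swo_trans : forall y x z, lt x y -> lt y z -> lt x z;
  swo_total : forall x y, [\/ lt x y, x = y | lt y x] }.

Lemma exists_strict_well_order (T : eqType) :
  exists lt : T -> T -> Prop, strict_well_order lt.
Proof.
have [R woR] := well_ordering_principle T.
have wo : wo_chain R (mem T) by move=> A _; apply: woR.
have Rtotal x y : R x y || R y x by apply: (wo_chainW wo).
have Ranti x y : R x y -> R y x -> x = y.
  by move=> xy yx; apply: (wo_chain_antisymmetric wo) => //; rewrite xy.
have minR (A : T -> Prop) x : A x -> exists2 z, A z & forall y, A y -> R z y.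
  move=> Ax; have [|z [[/asboolP Az lez] _]] := woR (fun z => `[< A z >]).
    by exists x; apply/asboolP.
  by exists z => // y Ay; apply: lez; apply/asboolP.
exists (fun x y => ~~ R y x); split.
- move=> x; apply: contrapT => nx.
  have [z nz lez] := minR (fun z => ~ Acc (fun x y => ~~ R y x) z) x nx.
  apply: nz; constructor => y /negP ltyz; apply: contrapT => ny.
  by apply: ltyz; apply: lez.
- move=> y x z /negP xy /negP yz; apply/negP => zx.
  have [t tP le] := minR (fun t => [\/ t = x, t = y | t = z]) x (Or31 _ _ erefl).
  have tx := le x (Or31 _ _ erefl); have ty := le y (Or32 _ _ erefl).
  have tz := le z (Or33 _ _ erefl).
  case: tP => te; rewrite te in tx ty tz; last exact: yz.
    by apply: yz; rewrite (Ranti z x).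
  exact: xy.
- move=> x y; case: (boolP (R y x)) => yx; last by constructor 1.
  case: (boolP (R x y)) => xy; last by constructor 3.
  by constructor 2; apply: Ranti.
Qed.

Section WellOrder.
Context (T : Type) (lt : T -> T -> Prop) (wo : strict_well_order lt).

Lemma swo_min (A : T -> Prop) x : A x ->
  exists2 z, A z & forall y, lt y z -> ~ A y.
Proof.
elim/(well_founded_ind (swo_wf wo)): x => x IH Ax.
have [[y yx Ay]|no] := pselect (exists2 y, lt y x & A y); first exact: IH yx Ay.
by exists x => // y yx Ay; apply: no; exists y.
Qed.

(* The order type of the initial segment below [x], as a von Neumann ordinal. *)
Definition rank : T -> V :=
  Fix (swo_wf wo) (fun=> V)
    (fun x rec => Sup (fun y : {y | lt y x} => rec (sval y) (svalP y))).

Lemma mem_rank v x : memV v (rank x) <-> exists2 y, lt y x & eqV v (rank y).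
Proof.
have -> : rank x = Sup (fun y : {y | lt y x} => rank (sval y)).
  rewrite /rank Fix_eq// => {}x f g fg; congr Sup.
  by apply: funext => y; apply: fg.
split=> [[[y yx] e]|[y yx e]]; first by exists y.
by exists (exist _ y yx).
Qed.

Lemma rank_inj x y : eqV (rank x) (rank y) -> x = y.
Proof.
have irr a b : lt a b -> ~ eqV (rank a) (rank b).
  move=> ab e; apply: (@memV_irrefl (rank a)).
  have : memV (rank a) (rank b) by apply/mem_rank; exists a => //; apply: eqV_refl.
  by move/memV_eq; apply; apply: eqV_sym.
by have [/irr|//|/irr H /eqV_sym] := swo_total wo x y.
Qed.

End WellOrder.

Lemma memV_eql v v' w : eqV v v' -> memV v w -> memV v' w.
Proof. by case: w => B g e [j e']; exists j; apply: eqV_trans (eqV_sym e) e'. Qed.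

Section LeastName.
Context {d : Order.disp_t} {P : porderType d}.
Context (T : Type) (lt : T -> T -> Prop) (wo : strict_well_order lt).
Implicit Types (p q r s : P) (a x y z : name P).
Context (G : T -> P -> Prop).
Hypothesis G_le : forall t p q, (q <= p)%O -> G t p -> G t q.

(** The forcing negation of [G] at all indices up to [t]: only later indices remain possible for the
    least witness. *)
Definition avoids t p : Prop :=
  forall t' q, lt t' t \/ t' = t -> (q <= p)%O -> ~ G t' q.

(* A name for the rank of the least [t] such that [G t] holds in the generic
   filter (for the supremum of all the ranks, if there is none). *)
Definition least_name : name P :=
  Name (fun i : {i : T * P | avoids i.1 i.2} => check (rank wo (sval i).1))
       (fun i => (sval i).2).

Lemma forces_in_rank a t p phi : forces p (fMem a (check (rank wo t))) ->
  (forall q t', (q <= p)%O -> lt t' t -> forces_eq a (check (rank wo t')) q ->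
     forces q phi) -> forces p phi.
Proof.
move=> at_ H; apply: forces_in_check at_ _ => q v qp /mem_rank[t' lt' e] ae.
by apply: H lt' _ => //; apply: forces_eq_trans ae _; apply: check_eq.
Qed.

(** Avoiding [t] entails avoiding every smaller index under the same condition, so the name denotes
    an initial segment of the ranks. *)
Lemma least_name_ordinal : ordinal_name least_name.
Proof.
move=> p; split.
  apply: forces_allinI => x q qp xa; apply: forces_allinI => y r rq yx.
  apply: forces_in (forces_le rq xa) _ => s i sr si xe.
  have {}yx : forces s (fMem y (check (rank wo (sval i).1))).
    exact: forces_mem_eq (forces_eq_refl _ _) xe (forces_le sr yx).
  apply: forces_in_rank yx _ => t j ts ji ye.
  have jE : avoids j (sval i).2.
    move=> t' u' H; apply: (svalP i); left.
    by case: H => [H|->//]; apply: (swo_trans wo) ji.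
  apply: (@forces_memI _ _ _ _ (exist _ (j, (sval i).2) jE : idx least_name)) ye.
  exact: le_trans si.
apply: forces_allinI => x q qp xa; apply: forces_allinI => y r rq yx.
apply: forces_allinI => z s sr zy.
apply: forces_in (forces_le (le_trans sr rq) xa) _ => t i ts ti xe.
have {}yx : forces t (fMem y (check (rank wo (sval i).1))).
  exact: forces_mem_eq (forces_eq_refl _ _) xe (forces_le (le_trans ts sr) yx).
apply: forces_in_rank yx _ => u j ut ji ye.
have {}zy : forces u (fMem z (check (rank wo j))).
  exact: forces_mem_eq (forces_eq_refl _ _) ye (forces_le (le_trans ut ts) zy).
apply: forces_in_rank zy _ => v k vu kj ze.
have ki : memV (rank wo k) (rank wo (sval i).1).
  by apply/mem_rank; exists k; [apply: (swo_trans wo) ji|apply: eqV_refl].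
apply: forces_mem_eq (forces_eq_sym ze) _ (check_mem v ki).
apply: forces_eq_sym; apply: forces_eq_le xe; exact: le_trans ut.
Qed.

(** A condition that satisfies [G] at the least index possible below [r] decides the name to be the
    rank of that index, and the decided value must lie in [C]. *)
Lemma least_nameP p (C : V) : forces p (fMem least_name (check C)) ->
  dense_below p (fun q => exists t, G t q) ->
  dense_below p (fun q => exists2 t, memV (rank wo t) C & G t q).
Proof.
move=> /forces_memE aC D; apply: dense_below_bind aC _ => q qp [i [qi ae]].
have [v vC ie] : exists2 v, memV v C & forces_eq least_name (check v) q.
  case: C i qi ae => B g i qi ae; exists (g i.1) => //.
  by exists i.1; apply: eqV_refl.
move=> r rq; have [s sr [t Gts]] := D r (le_trans rq qp).
have [|t0 [s0 s0r G0] tmin] :=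
  @swo_min _ _ wo (fun t => exists2 s, (s <= r)%O & G t s) t; first by exists s.
exists s0 => //; exists t0 => //.
suff e : forces_eq least_name (check (rank wo t0)) s0.
  apply: memV_eql vC; apply: (@check_eqE _ _ _ _ s0).
  apply: forces_eq_trans e; apply: forces_eq_sym.
  by apply: forces_eq_le ie; apply: le_trans s0r _.
(* An index avoided below [s0] precedes [t0], because [G t0] persists; conversely, minimality of
   [t0] makes every smaller index avoided. *)
apply: forces_ext => x u us0; split=> xa.
  apply: forces_in xa _ => w j wu wj xe.
  apply: forces_mem_eq (forces_eq_sym xe) (forces_eq_refl _ _) _.
  apply: check_mem; apply/mem_rank; exists (sval j).1; last exact: eqV_refl.
  have nG := svalP j _ _ _ wj.
  have Gw : G t0 w by apply: G_le G0; apply: le_trans us0.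
  by have [//|e|H] := swo_total wo (sval j).1 t0; case: (nG t0) => //; [right|left].
apply: forces_in_rank xa _ => w j wu jt xe.
have jE : avoids j w.
  move=> t' u' H u'w Gt'; apply: (tmin t').
    by case: H => [H|->//]; apply: (swo_trans wo) jt.
  by exists u' => //; do 3 (apply: le_trans; last by eassumption).
exact: (@forces_memI _ _ _ _ (exist _ (j, w) jE : idx least_name)) xe.
Qed.

End LeastName.

(** * Numerals and omega in the extension *)

Definition succV (v : V) : V :=
  let: Sup A f := v in Sup (fun o : option A => if o is Some i then f i else v).

Fixpoint natV (n : nat) : V :=
  if n is m.+1 then succV (natV m) else Sup (fun i : False => match i with end).

Definition omegaV : V := Sup natV.

Lemma mem_succV x v : memV x (succV v) <-> memV x v \/ eqV x v.
Proof.
case: v => A f; split=> [[[i|] e]|[[i e]|e]]; [by left; exists i|by right| |].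
  by exists (Some i).
by exists None.
Qed.

Lemma natV_inj m n : eqV (natV m) (natV n) -> m = n.
Proof.
have mem i j : (i < j)%N -> memV (natV i) (natV j).
  elim: j => // j IH; rewrite ltnS leq_eqVlt => /orP[/eqP->|/IH ij].
    by apply/mem_succV; right; apply: eqV_refl.
  by apply/mem_succV; left.
have irr i j : (i < j)%N -> ~ eqV (natV i) (natV j).
  move=> /mem ij e; apply: (@memV_irrefl (natV i)).
  exact: memV_eq ij (eqV_sym e).
by case: (ltngtP m n) => // /irr H // /eqV_sym.
Qed.

Section Omega.
Context {d : Order.disp_t} {P : porderType d}.
Implicit Types (p q r s : P) (a w x y z : name P).

Lemma check_empty p : forces p (is_empty (check (natV 0))).
Proof. by move=> x q qp /(_ q (lexx q))[r _ [[[]]]]. Qed.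

Lemma check_succ v p : forces p (is_succ (check (succV v)) (check v)).
Proof.
apply: forces_allI => x; apply: forces_iffI => q qp H.
  apply: forces_in_check H _ => r v' rq /mem_succV[vv|ee] e.
    by apply: forces_orIl; apply: forces_mem_eq (forces_eq_sym e)
      (forces_eq_refl _ _) (check_mem _ vv).
  by apply: forces_orIr; apply: forces_eq_trans e _; apply: check_eq.
apply: forces_orE H _ _ => r rq H.
  apply: forces_in_check H _ => s v' sr vv e.
  apply: forces_mem_eq (forces_eq_sym e) (forces_eq_refl _ _) (check_mem _ _).
  by apply/mem_succV; left.
apply: forces_mem_eq (forces_eq_sym H) (forces_eq_refl _ _) (check_mem _ _).
by apply/mem_succV; right; apply: eqV_refl.
Qed.

Lemma check_omega_inductive p : forces p (is_inductive (check omegaV)).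
Proof.
split.
  apply: (@forces_exI _ _ (check (natV 0))); split; last exact: check_empty.
  by apply: check_mem; exists 0%N; apply: eqV_refl.
apply: forces_allinI => n q qp nw.
apply: forces_in_check nw _ => r v rq [k ke] e.
have {}e : forces_eq n (check (natV k)) r.
  by apply: forces_eq_trans e _; apply: check_eq.
apply: (@forces_exI _ _ (check (natV k.+1))); split.
  by apply: check_mem; exists k.+1; apply: eqV_refl.
apply: forces_subst (check_succ (natV k) r).
by rewrite /is_succ; fcongruence; apply: forces_eq_sym.
Qed.

(** The check name of [omegaV] is inductive, so the least inductive set [w] is forced to be included
    in it. *)
Lemma forces_in_omega w a p phi : forces p (is_omega w) -> forces p (fMem a w) ->
  (forall q k, (q <= p)%O -> forces_eq a (check (natV k)) q -> forces q phi) ->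
  forces p phi.
Proof.
move=> [_ H] aw K.
have {}aw : forces p (fMem a (check omegaV)).
  exact: (H _ p (lexx p) (check_omega_inductive p)).
apply: forces_in_check aw _ => q v qp [k ke] e; apply: (K q k) => //.
by apply: forces_eq_trans e _; apply: check_eq.
Qed.

Lemma forces_natV w k p : forces p (is_omega w) ->
  forces p (fMem (check (natV k)) w).
Proof.
elim: k p => [|k IH] p wom.
  have [[H _] _] : forces p (is_omega w) := wom.
  have {}H : forces p (EXIN z OF w, is_empty z)%fml := H.
  apply: forces_exE H _ => q z qp [zw ze].
  apply: forces_mem_eq _ (forces_eq_refl _ _) zw.
  apply: forces_ext => x r rq; split=> H.
    by case: (ze x r rq).
  by case: (check_empty (lexx r) H).
have kw := IH p wom; have [[_ /(_ _ p (lexx p) kw) H] _] := wom.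
have {}H : forces p (EXIN s OF w, is_succ s (check (natV k)))%fml := H.
apply: forces_exE H _ => q z qp [zw ze].
apply: forces_mem_eq _ (forces_eq_refl _ _) zw.
apply: forces_ext => x r rq.
have [h1 h2] := ze x; have [h3 h4] := check_succ (natV k) r x.
by split=> [/(h1 r rq)/(h4 r (lexx r))|/(h3 r (lexx r))/(h2 r rq)].
Qed.

End Omega.

(** * Selections in the ground model and in the extension *)

(** The type enumerating [C] is finite, as [nat] does not inject into it, and each enumerated set is
    the code of at most one [t]. *)
Lemma card_ltV_nat_finite (T : eqType) (c : T -> V) (C : V) :
  point_coding c -> card_ltV C nat ->
  exists s : seq T, forall t, t \in s <-> memV (c t) C.
Proof.
move=> c_inj [B [f [Cf noinj]]].
have finB : finite_set [set: B].
  by apply: contrapT => /infiniteP.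
suff : finite_set [set t | memV (c t) C].
  move=> /finite_seqP[s sE]; exists s => t.
  have -> : (memV (c t) C) = [set t | memV (c t) C] t by [].
  by rewrite sE.
have [[t0 _]|noT] := pselect (exists t : T, True); last first.
  rewrite (_ : mkset _ = set0); first exact: finite_set0.
  by apply/seteqP; split=> // t; case: noT; exists t.
have /choice[g gP] : forall j, exists t, forall t', eqV (c t') (f j) -> t' = t.
  move=> j; have [[t tj]|no] := pselect (exists t, eqV (c t) (f j)).
    by exists t => t' t'j; apply: c_inj; apply: eqV_trans t'j (eqV_sym tj).
  by exists t0 => t' t'j; case: no; exists t'.
apply: sub_finite_set (finite_image g finB) => t /= tC.
by have /= [j tj] := memV_eq tC Cf; exists j => //; rewrite (gP j t).
Qed.

Section Selection.
Context {d : Order.disp_t} {P : porderType d} (X : topologicalType).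
Implicit Types (p q r s : P).

(* [G n x A s] is read: [s] forces the open neighbourhood [A] of [x] to refine
   the [n]-th cover. *)
Lemma CG_selection (G : nat -> X -> set X -> P -> Prop) r :
  Rothberger X -> TWO_wins_CG_omega_finite P ->
  (forall n x A p q, (q <= p)%O -> G n x A p -> G n x A q) ->
  (forall n x A p, G n x A p -> open A /\ A x) ->
  (forall n x, dense_below r (fun s => exists A, G n x A s)) ->
  exists (q : P) (W : nat -> set X), [/\ (q <= r)%O,
    forall x, exists n, W n x &
    forall n, dense_below q (fun s => exists x A, W n `<=` A /\ G n x A s)].
Proof.
move=> roth [S [Sna Swin]] G_le G_open Gdense.
have [lt wo] := exists_strict_well_order (set X).
have [x0 _] := Rothberger_point roth.
pose eta n x := least_name wo (G n x).
(* ONE's moves along the points [xs]; the top inning [None] of omega + 1 gets the default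
   [eta 0 x0]. *)
pose play (xs : nat -> X) i := if i is Some k then eta k (xs k) else eta 0 x0.
have play_ord xs i : ordinal_name (play xs i).
  by case: i => [k|]; apply: least_name_ordinal.
(* The move [W h x] of ONE in the Rothberger game after TWO has chosen the
   points [h] is the intersection of the finitely many neighbourhoods of [x]
   whose rank TWO allows in the cut-and-choose game. *)
pose answer h x := S r (play (nth x0 (rcons h x))) (Some (size h)).
pose W h x := [set y | forall A, open A -> A x ->
  memV (rank wo A) (answer h x) -> A y].
have oW h x : open (W h x).
  have [legal _] := Swin r _ (play_ord (nth x0 (rcons h x))).
  have [_ /(card_ltV_nat_finite (@rank_inj _ _ wo))[s sP]] := legal (Some (size h)).
  rewrite (_ : W h x = [set y | forall A, A \in s -> (open A -> A x -> A y)]).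
    apply: (@open_forall_seq _ _ _ (fun A => [set y | open A -> A x -> A y])).
    move=> A; have [oAx|noAx] := pselect (open A /\ A x).
      rewrite (_ : mkset _ = A); first by case: oAx.
      by case: oAx => oA Ax; apply/seteqP; split=> y /=; [apply|].
    rewrite (_ : mkset _ = [set _ | True]); first exact: open_cst.
    by apply/seteqP; split=> // y _ oA Ax; case: noAx.
  by apply/seteqP; split=> y Wy A; [move=> /sP|move=> oA Ax /sP] => *; apply: Wy.
have Wx h x : W h x x by [].
(* The constant sequence of the cover by the sets [W h x] yields a countable subcover, so that ONE's
   strategy can be coded as a tree over [nat]. *)
have /choice[e eP] : forall h, exists e : nat -> X, forall y, exists k, W h (e k) y.
  move=> h; have [||e [_ eP]] := @Rothberger_choice _ roth X (fun _ _ => True)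
    (fun _ => W h); by [move=> *; apply: oW|move=> _ x; exists x|exists e].
pose pos := foldl (fun h k => rcons h (e h k)) [::].
have [||f fP] := @Rothberger_branch _ roth (fun l k => W (pos l) (e (pos l) k)).
- by move=> l k; apply: oW.
- by move=> l; apply: eP.
pose h n := pos (mkseq f n).
pose xs n := e (h n) (f n).
have hS n : h n.+1 = rcons (h n) (xs n).
  by rewrite /h /mkseq -addn1 iotaD map_cat /= /pos foldl_cat.
have size_h n : size (h n) = n by elim: n => // n IH; rewrite hS size_rcons IH.
have nth_h n k : k < n -> nth x0 (h n) k = xs k.
  elim: n => // n IH; rewrite ltnS leq_eqVlt hS nth_rcons size_h.
  by case: ltngtP => [/IH->| |->] //=; rewrite ?eqxx.
(* The bound [None] lies above all finite innings and so gives a single condition for all of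
   them. *)
have [_ /(_ None)[q qr qP]] := Swin r _ (play_ord xs).
exists q, (fun n => W (h n) (xs n)); split=> // n.
(* The play behind [answer] continues with the default [x0] but agrees with [xs] up to inning [n],
   so non-anticipation gives the same answer. *)
have answerE : answer (h n) (xs n) = S r (play xs) (Some n).
  rewrite /answer size_h -hS; apply: Sna => -[k|] [] //= kn.
    by rewrite nth_h // ltnW.
  by case: kn => ->; rewrite nth_h.
have := qP (Some n) I; rewrite -answerE => qn.
have D := least_nameP (G_le n (xs n)) qn (dense_below_le qr (Gdense n (xs n))).
apply: dense_below_bind D _ => s sq [A memA GA].
apply: dense_below_self => t ts; exists (xs n), A; split; last exact: G_le GA.
by have [oA Ax] := G_open _ _ _ _ GA; move=> y /(_ A oA Ax memA).
Qed.

End Selection.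

(** * Choosing one condition along the generic filter *)

Section LeastChoice.
Context {d : Order.disp_t} {P : porderType d}.
Context (lt : P -> P -> Prop) (wo : strict_well_order lt) (D : P -> Prop).
Implicit Types (p q r s t : P).

(* [s] is the first condition of [D] that is compatible with [t]. *)
Definition first_above t s : Prop :=
  [/\ D s, (t <= s)%O &
    forall s' t', lt s' s -> D s' -> (t' <= t)%O -> ~ (t' <= s')%O].

(** Minimize [s] over the members of [D] that have an extension below [r], and take such an
    extension as [t]. *)
Lemma first_above_dense q : dense_below q D ->
  dense_below q (fun t => exists s, first_above t s).
Proof.
move=> Dq r rq; have [s0 s0r Ds0] := Dq r rq.
have [|s [Ds [t tr ts]] smin] := @swo_min _ _ wo
    (fun s => D s /\ exists2 t, (t <= r)%O & (t <= s)%O) s0.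
  by split=> //; exists s0.
exists t => //; exists s; split=> // s' t' s's Ds' t't t's'.
by apply: (smin s') => //; split=> //; exists t' => //; apply: le_trans tr.
Qed.

(** If [s] and [s'] differed, [r] would make the smaller one compatible with both conditions,
    against the minimality of the other. This makes the selection single-valued. *)
Lemma first_above_uniq r t t' s s' : first_above t s -> first_above t' s' ->
  (r <= t)%O -> (r <= t')%O -> s = s'.
Proof.
move=> [Ds ts no] [Ds' ts' no'] rt rt'; have [ss'|//|s's] := swo_total wo s s'.
  by case: (no' s r ss' Ds rt'); apply: le_trans ts.
by case: (no s' r s's Ds' rt); apply: le_trans ts'.
Qed.

End LeastChoice.

(** * Open covers and selections in the extension *)

Section Preservation.
Context {d : Order.disp_t} {P : porderType d} (X : topologicalType) (c : X -> V).
Context (tauP : name P).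
Implicit Types (p q r s t : P) (a b y z u : name P).

Let points := check (P := P) (set_of_points c [set: X]).
Hypothesis c_inj : point_coding c.
Hypothesis tauP_gen :
  forced (is_generated_topology points (check (set_of_opens c)) tauP).

Lemma mem_set_of_points A x0 : memV (c x0) (set_of_points c A) <-> A x0.
Proof.
split=> [[[x1 Ax1] /c_inj ->]|Ax0] //.
by exists (exist _ x0 Ax0); apply: eqV_refl.
Qed.

(** Since the base is a check name, a basic neighbourhood inside [u] is densely decided to be a
    ground-model open set, and membership of [c x0] in it is absolute. *)
Lemma generated_open p u x0 : forces p (fMem u tauP) ->
  forces p (fMem (check (c x0)) u) ->
  dense_below p (fun q => exists A,
    [/\ open A, A x0 & forces q (is_subset (check (set_of_points c A)) u)]).
Proof.
move=> uT xu; have [/(_ p (lexx p) uT)[_ H] _] := tauP_gen p u.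
have := H (check (c x0)) p (lexx p) xu.
move=> /dense_below_bind; apply=> q qp [b [/forces_memE bB [xb bu]]].
have {}xb : forces q (fMem (check (c x0)) b) := xb.
have {}bu : forces q (is_subset b u) := bu.
apply: dense_below_bind bB _ => r rq [[[A oA] s] [_ be]].
have {}be : forces_eq b (check (set_of_points c A)) r := be.
apply: dense_below_self => t tr; exists A; split=> //.
  have xA : forces r (fMem (check (c x0)) (check (set_of_points c A))).
    exact: forces_mem_eq (forces_eq_refl _ _) be (forces_le rq xb).
  exact/mem_set_of_points/(check_memE xA).
apply: forces_le tr _; apply: forces_subst (forces_le rq bu).
by rewrite /is_subset; fcongruence.
Qed.

Context (w F : name P) (p0 : P).
Hypothesis w_omega : forces p0 (is_omega w).
Hypothesis F_fun : forces p0 (is_function_on F w).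
Hypothesis F_cover : forces p0 (ALLIN n OF w, ALL U,
  maps_to F n U ⇒ is_open_cover points tauP U)%fml.

Lemma nat_in_omega n p : (p <= p0)%O -> forces p (fMem (check (natV n)) w).
Proof. by move=> pp; apply: forces_natV; apply: forces_le w_omega. Qed.

Lemma F_open_cover n U p : (p <= p0)%O ->
  forces p (maps_to F (check (natV n)) U) ->
  forces p (is_open_cover points tauP U).
Proof.
by move=> pp FU; apply: F_cover pp (nat_in_omega n pp) _ _ (lexx p) FU.
Qed.

Definition refines n A p u U : Prop :=
  [/\ forces p (maps_to F (check (natV n)) U), forces p (fMem u U) &
      forces p (is_subset (check (set_of_points c A)) u)].

Lemma refines_le n A p q u U : (q <= p)%O ->
  refines n A p u U -> refines n A q u U.
Proof. by move=> qp [h1 h2 h3]; split; apply: forces_le qp _. Qed.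

Lemma refines_subset n A B p u U : A `<=` B ->
  refines n B p u U -> refines n A p u U.
Proof.
move=> AB [h1 h2 h3]; split=> //.
apply: forces_allinI => x q qp xA; apply: h3 => //.
apply: (forces_is_subset (w := set_of_points c B)) xA => //.
by move=> v [[x0 Ax0] e]; exists (exist _ x0 (AB _ Ax0)).
Qed.

(** The [n]-th cover has a member around [x0], inside which a ground-model open set is decided. This
    supplies the density that the game argument requires. *)
Lemma refines_dense n x0 p : (p <= p0)%O -> dense_below p (fun q =>
  exists A, [/\ open A, A x0 & exists u U, refines n A q u U]).
Proof.
move=> pp.
have := function_onE (forces_le pp F_fun) (nat_in_omega n pp).
move=> /dense_below_bind; apply=> q qp [U [FU _]].
have {}FU : forces q (maps_to F (check (natV n)) U) := FU.
have qp0 := le_trans qp pp.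
have [UT Ucov] := F_open_cover qp0 FU.
have xX : forces q (fMem (check (c x0)) points).
  by apply: check_mem; apply/mem_set_of_points.
have := Ucov _ q (lexx q) xX.
move=> /dense_below_bind; apply=> r rq [u [uU xu]].
have {}uU : forces r (fMem u U) := uU.
have uT : forces r (fMem u tauP) by apply: UT rq uU.
apply: dense_below_bind (generated_open uT xu) _ => s sr [A [oA Ax Au]].
apply: dense_below_self => t ts; exists A; split=> //; exists u, U.
apply: refines_le ts _; split=> //; last exact: forces_le uU.
by apply: forces_le FU; apply: le_trans rq.
Qed.

Context (q0 : P) (W : nat -> set X).
Hypothesis q0_le : (q0 <= p0)%O.
Hypothesis W_cover : forall x, exists n, W n x.
Hypothesis W_refines :
  forall n, dense_below q0 (fun s => exists u U, refines n (W n) s u U).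

(* The selection [G] takes at [n] the value [u_ (n, s)] for the first [s], in a
   well-order of [P], among the conditions of the generic filter that decide a
   suitable member of the [n]-th cover. *)
Lemma exists_selection : exists G, forces q0 (is_function_on G w ⩑
  (ALLIN n OF w, ALL u, ALL U, maps_to G n u ⇒ maps_to F n U ⇒ u ∈ U) ⩑
  (EX R, is_range R G ⩑ is_open_cover points tauP R))%fml.
Proof.
have [lt wo] := exists_strict_well_order P.
pose D n s := exists u U, refines n (W n) s u U.
have /choice[u_ uP] : forall ns : nat * P, exists u, D ns.1 ns.2 ->
    exists U, refines ns.1 (W ns.1) ns.2 u U.
  move=> [n s]; have [[u Du]|nD] := pselect (D n s); first by exists u.
  (* [w] is a mere default name. *)
  by exists w.
(* In a triple [(n, s, t)] the condition [t] has [s] as its first compatible member of [D n], and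
   puts the pair of [n] and [u_ (n, s)] into [G]. *)
pose I := {i : nat * P * P | first_above lt (D i.1.1) i.2 i.1.2}.
pose G := Name (fun i : I => opair_name (check (natV (sval i).1.1)) (u_ (sval i).1))
  (fun i => (sval i).2).
pose R := Name (fun i : I => u_ (sval i).1) (fun i => (sval i).2).
have G_elim a b p phi : forces p (maps_to G a b) ->
    (forall q (i : I), (q <= p)%O -> (q <= (sval i).2)%O ->
       forces_eq a (check (natV (sval i).1.1)) q ->
       forces_eq b (u_ (sval i).1) q -> forces q phi) -> forces p phi.
  move=> Gab H; apply: forces_exE Gab _ => q z qp [zG zab].
  have {}zG : forces q (fMem z G) := zG.
  have {}zab : forces q (is_opair z a b) := zab.
  apply: forces_in zG _ => r i rq ri ze.
  have zi : forces r (is_opair z (check (natV (sval i).1.1)) (u_ (sval i).1)).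
    apply: forces_subst (opair_nameP _ _ r).
    by rewrite /is_opair /is_upair; fcongruence; apply: forces_eq_sym.
  have [ea eb] := opair_inj (forces_le rq zab) zi.
  exact: H (le_trans rq qp) ri ea eb.
have G_intro (i : I) p : (p <= (sval i).2)%O ->
    forces p (maps_to G (check (natV (sval i).1.1)) (u_ (sval i).1)).
  move=> pi.
  apply: (forces_exI (x := opair_name (check (natV (sval i).1.1)) (u_ (sval i).1))).
  split; last exact: opair_nameP.
  exact: (@forces_memI _ _ _ G i _ pi (forces_eq_refl _ _)).
have first_dense n q : (q <= q0)%O -> dense_below q (fun t =>
    exists i : I, (sval i).1.1 = n /\ (t <= (sval i).2)%O).
  move=> qq; have Dq : dense_below q (D n) := dense_below_le qq (W_refines n).
  apply: dense_below_bind (first_above_dense wo Dq) _ => t tq [s ts].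
  by apply: dense_below_self => r rt; exists (exist _ (n, s, t) ts).
have refinesI (i : I) q : (q <= (sval i).2)%O ->
    exists U, refines (sval i).1.1 (W (sval i).1.1) q (u_ (sval i).1) U.
  case: i => -[[n s] t] /= [Ds ts _] qt; have [U rU] := uP (n, s) Ds.
  by exists U; apply: refines_le rU; apply: le_trans ts.
exists G; split; [split|split].
- apply: forces_allinI => z q qq zG; apply: forces_in zG _ => r i rq ri ze.
  apply: (forces_exI (x := check (natV (sval i).1.1))); split.
    by apply: nat_in_omega; apply: le_trans q0_le; apply: le_trans qq.
  apply: (forces_exI (x := u_ (sval i).1)).
  apply: forces_subst (opair_nameP _ _ r).
  by rewrite /is_opair /is_upair; fcongruence; apply: forces_eq_sym.
- apply: forces_allinI => a q qq aw.
  apply: forces_in_omega (forces_le (le_trans qq q0_le) w_omega) aw _ => r n rq ae.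
  apply: forces_local; apply: dense_below_bind (first_dense n r (le_trans rq qq)) _.
  move=> t tr [i [ni ti]]; apply: dense_below_self => t' t't.
  have t'i : (t' <= (sval i).2)%O := le_trans t't ti.
  have ae' : forces_eq a (check (natV n)) t' := forces_eq_le (le_trans t't tr) ae.
  apply: (forces_exI (x := u_ (sval i).1)); split.
    rewrite -ni in ae'.
    exact: maps_to_eq (forces_eq_refl _ _) (forces_eq_sym ae') (forces_eq_refl _ _)
      (G_intro i t' t'i).
  apply: forces_allI => y; apply: forces_impI => s st' Gay.
  apply: G_elim Gay _ => s' j s's sj ae'' ye.
  (* Equal check names give equal numerals, and two indices met below one condition share their
     first [s]; so both values are the same name. *)
  have nj : n = (sval j).1.1.
    apply/natV_inj/(@check_eqE _ _ _ _ s').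
    apply: forces_eq_trans ae''; apply/forces_eq_sym/(forces_eq_le _ ae').
    exact: le_trans st'.
  suff <- : (sval j).1 = (sval i).1 by [].
  have s'i : (s' <= (sval i).2)%O by do 2 (apply: le_trans; last by eassumption).
  rewrite [LHS]surjective_pairing [RHS]surjective_pairing -nj ni; congr pair.
  have := svalP j; rewrite -nj -ni => fj.
  exact: first_above_uniq fj (svalP i) sj s'i.
- apply: forces_allinI => a q qq aw.
  apply: forces_allI => u; apply: forces_allI => U.
  apply: forces_impI => q1 q1q Gau; apply: forces_impI => q2 q21 FaU.
  apply: G_elim (forces_le q21 Gau) _ => r i rq ri ae ue.
  (* [U'] is another name for the [n]-th cover; functionality of [F] identifies it with [U]. *)
  have [U' [FU' uU' _]] := refinesI i r ri.
  have rp0 : (r <= p0)%O.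
    by do 5 (apply: le_trans; last by eassumption).
  apply: forces_mem_eq (forces_eq_sym ue) _ uU'.
  apply: maps_to_fun (forces_le rp0 F_fun) (nat_in_omega _ rp0) FU' _.
  exact: maps_to_eq (forces_eq_refl _ _) ae (forces_eq_refl _ _) (forces_le rq FaU).
- apply: (forces_exI (x := R)); split; [|split].
  + apply: forces_allI => y; apply: forces_iffI => q qq H.
      apply: forces_in H _ => r i rq ri ye.
      apply: (forces_exI (x := check (natV (sval i).1.1))).
      exact: maps_to_eq (forces_eq_refl _ _) (forces_eq_refl _ _)
        (forces_eq_sym ye) (G_intro i r ri).
    apply: forces_exE H _ => r a rq Gay.
    apply: G_elim Gay _ => s i sr si ae ye.
    exact: (@forces_memI _ _ _ R i _ si ye).
  + apply: forces_allinI => y q qq yR; apply: forces_in yR _ => r i rq ri ye.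
    have [U [FU uU _]] := refinesI i r ri.
    have rp0 : (r <= p0)%O := le_trans (le_trans rq qq) q0_le.
    have [UT _] := F_open_cover rp0 FU.
    apply: forces_mem_eq (forces_eq_sym ye) (forces_eq_refl _ _) _.
    exact: (UT _ r (lexx r) uU).
  (* A name of a point is decided to be some [x0]; any [n] with [W n x0] works, since [W n] is
     forced into the set selected at [n]. *)
  + apply: forces_allinI => x q qq xX; apply: forces_in_check xX _ => r v rq.
    move=> [[x0 ?] ve] xe; have {}ve : eqV v (c x0) := ve; have [n Wn] := W_cover x0.
    apply: forces_local.
    apply: dense_below_bind (first_dense n r (le_trans rq qq)) _ => t tr [i [ni ti]].
    apply: dense_below_self => t' t't.
    have t'i : (t' <= (sval i).2)%O := le_trans t't ti.
    have [U [_ _ Wu]] := refinesI i t' t'i; rewrite ni in Wu.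
    apply: (forces_exI (x := u_ (sval i).1)); split.
      exact: (@forces_memI _ _ _ R i _ t'i (forces_eq_refl _ _)).
    have xW : forces t' (fMem (check (c x0)) (check (set_of_points c (W n)))).
      by apply: check_mem; apply/mem_set_of_points.
    apply: forces_mem_eq _ (forces_eq_refl _ _) (Wu _ t' (lexx t') xW).
    apply: forces_eq_trans (check_eq _ (eqV_sym ve)) _.
    by apply: forces_eq_sym; apply: forces_eq_le xe; apply: le_trans tr.
Qed.

End Preservation.

Theorem corollary5p2 (d : Order.disp_t) (P : porderType d)
    (X : topologicalType) (c : X -> V) (tauP : name P) :
  point_coding c ->
  Rothberger X ->
  TWO_wins_CG_omega_finite P ->
  forced (is_generated_topology
    (check (set_of_points c [set: X]%classic)) (check (set_of_opens c)) tauP) ->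
  forced (has_rothberger (check (set_of_points c [set: X]%classic)) tauP).
Proof.
move=> c_inj roth two gen p; apply: forces_allI => w.
apply: forces_impI => p1 p1p wom.
apply: forces_allI => F; apply: forces_impI => p2 p21 [Ffun Fcov].
have {}wom := forces_le p21 wom.
(* It suffices to find a selection densely: below any [r] the game provides a suitable [q]. *)
apply: forces_local => r rp2.
have [|||q [W [qr Wcov Wref]]] := @CG_selection _ _ _ (fun n x A s =>
  [/\ open A, A x & exists u U, refines c F n A s u U]) r roth two.
- move=> n x A s t ts [oA Ax [u [U R]]]; split=> //; exists u, U.
  exact: refines_le ts R.
- by move=> n x A s [oA Ax _].
- by move=> n x; apply: (refines_dense c_inj gen wom Ffun Fcov n x rp2).
have qp2 := le_trans qr rp2.
exists q => //.
have [|G HG] :=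
  @exists_selection _ _ _ c tauP c_inj w F p2 wom Ffun Fcov q W qp2 Wcov.
  move=> n; apply: dense_below_bind (Wref n) _ => s sq [x [A [WA [_ _ [u [U R]]]]]].
  apply: dense_below_self => t ts; exists u, U.
  by apply: refines_le ts _; apply: refines_subset R.
exact: (forces_exI (x := G)).
Qed.
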